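(* Let the symmetric group $S_n$ act on the space $\mathbb R^{\binom{[n]}{2}}$ of functions $f\colon\binom{[n]}{2}\to\mathbb R$ by $(\pi\cdot f)(\{i,j\})=f(\{\pi^{-1}(i),\pi^{-1}(j)\})$. Then $$\liminf_{n\to\infty}c_2\big(\mathbb R^{\binom{[n]}{2}}/S_n\big)=\infty.$$
   Context: $[n]:=\{1,\ldots,n\}$ and $\binom{[n]}{2}$ is the set of its two-element subsets; $\mathbb R^{\binom{[n]}{2}}$ carries the standard Euclidean norm. If a group $G$ acts by isometries on a metric space $X$ with closed orbits, the orbit space $X/G$ carries the quotient metric $d([x],[y])=\inf_{p\in[x],\,q\in[y]}d_X(p,q)$, where $[x]=G\cdot x$. For a map $f\colon X\to Y$ of metric spaces, let $\alpha,\beta\in[0,\infty]$ be the largest and smallest constants (respectively) with $\alpha\, d_X(x,x')\le d_Y(f(x),f(x'))\le\beta\, d_X(x,x')$ for all $x,x'\in X$; the distortion of $f$ is $\kappa(f):=\beta/\alpha$, with $\kappa(f)=\infty$ if $\alpha=0$ or $\beta=\infty$. The Euclidean distortion $c_2(X)\in[1,\infty]$ is the infimum of all $c$ for which there exist a Hilbert space $H$ and a map $f\colon X\to H$ with $\kappa(f)=c$. *)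

(* Defs.v *)
From HB Require Import structures.
From mathcomp Require Import all_boot all_order all_algebra all_fingroup.
From mathcomp Require Import all_classical all_reals all_analysis.
From mathcomp Require Import ring lra.

Set Implicit Arguments.
Unset Strict Implicit.
Unset Printing Implicit Defensive.

Import Order.TTheory GRing.Theory Num.Theory.
Import numFieldNormedType.Exports.

Local Open Scope classical_set_scope.
Local Open Scope ring_scope.

Section distortion.
Context {R : realType} {X Y : Type} (dX : X -> X -> R) (dY : Y -> Y -> R).
Local Open Scope ereal_scope.

(* The constants range over [0, +oo] inside \bar R, where +oo * 0 = 0. *)
Definition lower_const (f : X -> Y) : \bar R :=
  ereal_sup [set a | 0 <= a /\
    forall x x', a * (dX x x')%:E <= (dY (f x) (f x'))%:E].

Definition upper_const (f : X -> Y) : \bar R :=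
  ereal_inf [set b | 0 <= b /\
    forall x x', (dY (f x) (f x'))%:E <= b * (dX x x')%:E].

(* If X has at most one point, then the constants are +oo and 0 respectively
   and the quotient below is the junk value 0 * (+oo)^-1 = 0. *)
Definition distortion (f : X -> Y) : \bar R :=
  if (lower_const f == 0) || (upper_const f == +oo) then +oo
  else upper_const f / lower_const f.

End distortion.

Definition is_hilbert {R : realType} (H : completeNormedModType R) : Prop :=
  exists ip : {dot H for (@idfun R)}, forall u : H, `|u| ^+ 2 = ip u u.

Definition c2 {R : realType} (X : metricType R) : \bar R :=
  ereal_inf [set c | exists (H : completeNormedModType R) (f : X -> H),
    is_hilbert H /\
    distortion (@mdist R X) (fun u v : H => `|u - v|) f = c].

(* A finite group acting by isometries; orbits are then finite, hence closed. *)
Record isometric_action (R : realType) (gT : finGroupType) (X : metricType R) :=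
  IsometricAction {
    iact :> {action gT &-> X} ;
    iactP : forall (a : gT) (x y : X), mdist (iact x a) (iact y a) = mdist x y }.

Section isometric_action_theory.
Context {R : realType} {gT : finGroupType} {X : metricType R}.
Variable to : isometric_action gT X.

Lemma iactM x (a b : gT) : to x (a * b)%g = to (to x a) b.
Proof. by case: to => -[act [_ actP]] /= _; rewrite actP ?inE. Qed.

Lemma iact1 x : to x 1%g = x.
Proof.
have: to (to x 1%g) 1%g = to x 1%g by rewrite -iactM mulg1.
by case: to => -[act [actI actP]] /= _; exact: actI.
Qed.

Lemma iactK (a : gT) : cancel (to^~ a) (to^~ a^-1%g).
Proof. by move=> x; rewrite -iactM mulgV iact1. Qed.

End isometric_action_theory.

Section orbit_space.
Context {R : realType} {gT : finGroupType} {X : metricType R}.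
Variable to : isometric_action gT X.

Definition orbit_of (x : X) : set X := [set to x a | a in [set: gT]].

Definition orbit_space : Type := {O : set X | exists x, O = orbit_of x}.

HB.instance Definition _ := gen_eqMixin orbit_space.
HB.instance Definition _ := gen_choiceMixin orbit_space.

Definition orbit_dist (O P : orbit_space) : R :=
  inf [set mdist p q | p in sval O & q in sval P].

Let dset (O P : orbit_space) := [set mdist p q | p in sval O & q in sval P].

Let orbit_rep (O : orbit_space) : exists p, sval O p.
Proof.
case: O => [U [y Uy]]; exists y; rewrite /= Uy.
by exists 1%g => //; rewrite iact1.
Qed.

Let dset_has_inf O P : has_inf (dset O P).
Proof.
split.
  have [p Op] := orbit_rep O; have [q Pq] := orbit_rep P.
  by exists (mdist p q), p => //; exists q.
by exists 0 => _ [p _ [q _ <-]]; exact: mdist_ge0.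
Qed.

Let orbit_dist_lb (O P : orbit_space) p q :
  sval O p -> sval P q -> orbit_dist O P <= mdist p q.
Proof.
move=> Op Pq; apply: ge_inf; first by case: (dset_has_inf O P).
by exists p => //; exists q.
Qed.

Let orbit_mem (O : orbit_space) p (a : gT) : sval O p -> sval O (to p a).
Proof.
case: O => [U [x Ox]] /=; rewrite Ox => -[b _ <-].
by exists (b * a)%g => //; rewrite iactM.
Qed.

Let orbit_trans (O : orbit_space) p q : sval O p -> sval O q ->
  exists a : gT, q = to p a.
Proof.
case: O => [U [x Ox]] /=; rewrite Ox => -[b _ <-] [c _ <-].
by exists (b^-1 * c)%g; rewrite iactM iactK.
Qed.

Let orbit_attain (O P : orbit_space) p : sval O p ->
  exists2 q, sval P q & orbit_dist O P = mdist p q.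
Proof.
move=> Op; have [y Py] := orbit_rep P.
pose a := [arg min_(a < 1%g : gT) mdist p (to y a)]%O.
exists (to y a); first exact: orbit_mem.
apply/eqP; rewrite eq_le orbit_dist_lb//=; last exact: orbit_mem.
apply: lb_le_inf; first by case: (dset_has_inf O P).
move=> _ [p' Op' [q' Pq' <-]].
have [b ->] := orbit_trans Op Op'; have [c ->] := orbit_trans Py Pq'.
rewrite -(iactP to b^-1%g (to p b)) iactK -iactM /a.
by case: arg_minP => // i _ /(_ (c * b^-1)%g); exact.
Qed.

Let orbit_eq (O P : orbit_space) p : sval O p -> sval P p -> O = P.
Proof.
move=> Op Pp; suff OP : sval O = sval P.
  case: O P OP {Op Pp} => [U hU] [V hV] /= UV; subst V.
  by congr exist; exact: Prop_irrelevance.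
apply/seteqP; split => q.
  by move=> /(orbit_trans Op)[a ->]; exact: orbit_mem.
by move=> /(orbit_trans Pp)[a ->]; exact: orbit_mem.
Qed.

Let orbit_distxx O : orbit_dist O O = 0.
Proof.
have [p Op] := orbit_rep O; apply/eqP; rewrite eq_le.
rewrite -{1}(mdistxx p) orbit_dist_lb//=.
by have [q _ ->] := orbit_attain O Op; exact: mdist_ge0.
Qed.

Let orbit_dist_eq0 O P : orbit_dist O P = 0 -> O = P.
Proof.
have [p Op] := orbit_rep O; have [q Pq ->] := orbit_attain P Op.
by move/mdist_positivity => pq; apply: (@orbit_eq _ _ p) => //; rewrite pq.
Qed.

Let orbit_dist_sym O P : orbit_dist O P = orbit_dist P O.
Proof.
wlog suff: O P / orbit_dist O P <= orbit_dist P O.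
  by move=> h; apply/eqP; rewrite eq_le !h.
have [p Pp] := orbit_rep P; have [q Oq ->] := orbit_attain O Pp.
by rewrite metric_sym orbit_dist_lb.
Qed.

Let orbit_dist_triangle P O Q :
  orbit_dist O Q <= orbit_dist O P + orbit_dist P Q.
Proof.
have [p Op] := orbit_rep O; have [q Pq ->] := orbit_attain P Op.
have [r Qr ->] := orbit_attain Q Pq.
by rewrite (le_trans (orbit_dist_lb Op Qr))// metric_triangle.
Qed.

HB.instance Definition _ := @isMetric.Build R orbit_space
  orbit_dist orbit_distxx orbit_dist_eq0 orbit_dist_sym orbit_dist_triangle.

End orbit_space.

(* The index set [n] is 'I_n. *)
Definition two_subset (n : nat) := {A : {set 'I_n} | #|A| == 2}.

Definition edge_space (R : realType) (n : nat) := {ffun two_subset n -> R}.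

Section euclidean_metric.
Context {R : realType} {n : nat}.
Local Notation E := (edge_space R n).
Implicit Types f g h : E.

HB.instance Definition _ := GRing.Lmodule.on E.

Definition enorm f : R := Num.sqrt (\sum_e f e ^+ 2).

Definition edist f g : R := enorm (f - g).

Let sumsq_ge0 f : 0 <= \sum_e f e ^+ 2.
Proof. by apply: sumr_ge0 => e _; exact: sqr_ge0. Qed.

Let cauchy_schwarz f g : \sum_e f e * g e <= enorm f * enorm g.
Proof.
set A := \sum_e f e ^+ 2; set B := \sum_e g e ^+ 2; set C := \sum_e _.
rewrite /enorm -sqrtrM ?sumsq_ge0// -/A -/B.
have A0 : 0 <= A := sumsq_ge0 f.
have B0 : 0 <= B := sumsq_ge0 g.
have quad : 0 <= 2 * (A * B - C ^+ 2).
  have -> : 2 * (A * B - C ^+ 2) =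
            \sum_e \sum_e' (f e * g e' - f e' * g e) ^+ 2.
    transitivity (\sum_e \sum_e' (f e ^+ 2 * g e' ^+ 2 + f e' ^+ 2 * g e ^+ 2
      + (-2) * ((f e * g e) * (f e' * g e')))); last first.
      by apply: eq_bigr => e _; apply: eq_bigr => e' _; ring.
    symmetry; transitivity (\sum_e (f e ^+ 2 * B + g e ^+ 2 * A
      + (-2) * C * (f e * g e))).
      apply: eq_bigr => e _; rewrite !big_split /= /A /B /C !mulr_sumr.
      by rewrite !mulr_suml; congr (_ + _ + _); apply: eq_bigr => e' _; ring.
    by rewrite !big_split /= -!mulr_suml -mulr_sumr -/A -/B -/C; ring.
  by do 2![apply: sumr_ge0 => ? _]; exact: sqr_ge0.
apply: (le_trans (ler_norm _)); rewrite -sqrtr_sqr ler_wsqrtr//; lra.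
Qed.

Let enormD f g : enorm (f + g) <= enorm f + enorm g.
Proof.
rewrite -(@ler_pXn2r _ 2)// ?nnegrE ?addr_ge0 ?sqrtr_ge0//.
rewrite sqrrD !sqr_sqrtr ?sumsq_ge0//.
have -> : \sum_e (f + g) e ^+ 2 =
    \sum_e f e ^+ 2 + (\sum_e f e * g e) *+ 2 + \sum_e g e ^+ 2.
  by rewrite -sumrMnl -!big_split; apply: eq_bigr => e _; rewrite ffunE sqrrD.
by rewrite lerD2r lerD2l lerMn2r/= cauchy_schwarz.
Qed.

Let edistxx f : edist f f = 0.
Proof.
by rewrite /edist subrr /enorm big1 ?sqrtr0// => e _; rewrite ffunE expr0n.
Qed.

Let edist_eq0 f g : edist f g = 0 -> f = g.
Proof.
move=> /eqP; rewrite sqrtr_eq0 => le0; apply/ffunP => e.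
have /eqP : \sum_e (f - g) e ^+ 2 = 0 by apply/eqP; rewrite eq_le le0 sumsq_ge0.
rewrite psumr_eq0 => [/allP/(_ e (mem_index_enum _))/=|? _]; last exact: sqr_ge0.
by rewrite sqrf_eq0 !ffunE subr_eq0 => /eqP.
Qed.

Let edist_sym f g : edist f g = edist g f.
Proof.
by congr Num.sqrt; apply: eq_bigr => e _; rewrite !ffunE -sqrrN opprB.
Qed.

Let edist_triangle g f h : edist f h <= edist f g + edist g h.
Proof. by rewrite /edist -{1}(subrKA g) enormD. Qed.

HB.instance Definition _ :=
  @isMetric.Build R E edist edistxx edist_eq0 edist_sym edist_triangle.

End euclidean_metric.

Section permutation_action.
Context {R : realType} {n : nat}.
Implicit Types (s t : {perm 'I_n}) (e : two_subset n) (f : edge_space R n).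

Let relabel_subproof s e : #|s @: val e| == 2.
Proof. by rewrite card_imset ?(valP e)//; exact: perm_inj. Qed.

(* {i, j} |-> {s i, s j} *)
Definition relabel s e : two_subset n :=
  exist _ (s @: val e) (relabel_subproof s e).

(* Permutations compose as (s * t) x = t (s x), so the usual left action
   pi . f is a right action of the library's group {perm 'I_n}. *)
Definition edge_act_fun f s : edge_space R n := [ffun e => f (relabel s^-1%g e)].

Let relabelM s t e : relabel t (relabel s e) = relabel (s * t)%g e.
Proof.
apply: val_inj; rewrite /= -imset_comp.
by apply: eq_imset => i /=; rewrite permM.
Qed.

Let relabel1 e : relabel 1%g e = e.
Proof.
by apply: val_inj; rewrite /= (eq_imset _ (@perm1 _)) imset_id.
Qed.

Let edge_act1 : edge_act_fun^~ 1%g =1 id.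
Proof. by move=> f; apply/ffunP => e; rewrite ffunE invg1 relabel1. Qed.

Let edge_actM f : act_morph edge_act_fun f.
Proof.
by move=> s t; apply/ffunP => e; rewrite !ffunE relabelM invMg.
Qed.

Definition edge_act : {action {perm 'I_n} &-> edge_space R n} :=
  TotalAction edge_act1 edge_actM.

Let edge_act_isometry s f g : mdist (edge_act f s) (edge_act g s) = mdist f g.
Proof.
rewrite /mdist/= /edist /enorm; congr Num.sqrt.
rewrite [RHS](reindex (relabel s^-1%g)) /=.
  by apply: eq_bigr => e _; rewrite !ffunE.
exists (relabel s) => e _; first by rewrite relabelM mulVg relabel1.
by rewrite relabelM mulgV relabel1.
Qed.

Definition edge_isom_act : isometric_action {perm 'I_n} (edge_space R n) :=
  IsometricAction edge_act_isometry.

End permutation_action.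

Definition graph_orbit_space (R : realType) (n : nat) : metricType R :=
  orbit_space (@edge_isom_act R n).

(* Main.v *)
Require Import Defs.
From mathcomp Require Import all_boot all_order all_algebra all_fingroup.
From mathcomp Require Import all_classical all_reals all_analysis.
From mathcomp Require Import zify ring lra.

(* Let K be a finite field with q elements and C the Reed-Solomon code of
   polynomials of degree < s, viewed as functions on K.  On the vertices
   C + K * K put a heavy weight on the edge {f, (j, a)} that encodes
   (j, a - f j): the automorphisms of this weighted graph are the translations
   by C.  Adding 1 to the edges {f, (j, x j)} for a function x : K -> K gives a
   graph G_x, and since only automorphisms of the heavy graph are affordable,
   the squared distance from G_x to the orbit of G_y is 2|C| times the Hamming
   distance between x and y + C.

   Hence a map on orbits gives a C-invariant function on K^K.  As C surjects
   onto the values at any s points, such a function has no Efron-Stein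
   component of order 1, ..., s, so that its variance is at most 1/(s+1) times
   the sum of its coordinate variances.  The latter involve squared distances
   at most 2|C|, while for q large compared to s most pairs have Hamming
   distance modulo C more than q/4 since C is small.  The distortion is
   therefore at least of order sqrt s. *)

Set Implicit Arguments.
Unset Strict Implicit.
Unset Printing Implicit Defensive.

Import Order.TTheory GRing.Theory Num.Theory.
Import numFieldNormedType.Exports.
Local Open Scope ring_scope.


(** * A spectral gap for commuting projections *)

Section commuting_projections.
Context {R : numDomainType} {V : zmodType} {I : eqType}.
Variables (P : I -> V -> V) (N : V -> R).
Hypothesis PB : forall i u v, P i (u - v) = P i u - P i v.
Hypothesis PC : forall i j u, P i (P j u) = P j (P i u).
Hypothesis N0 : N 0 = 0.
Hypothesis N_ge0 : forall u, 0 <= N u.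
Hypothesis NP : forall i u, N u = N (P i u) + N (u - P i u).

Let P0 i : P i 0 = 0.
Proof. by rewrite -(subrr 0) PB !subrr. Qed.

Let foldrB T u v : foldr P (u - v) T = foldr P u T - foldr P v T.
Proof. by elim: T => //= i T ->; rewrite PB. Qed.

Let foldrP i T u : foldr P (P i u) T = P i (foldr P u T).
Proof. by elim: T => //= j T ->; rewrite PC. Qed.

(* Splitting u into P j u and u - P j u for the head j of l, the first summand
   satisfies the hypothesis for m, the second one for m - 1. *)
Lemma spectral_gap (l : seq I) (m : nat) (u : V) :
  (forall T, subseq T l -> (size l < m + size T)%N -> foldr P u T = 0) ->
  m%:R * N u <= \sum_(i <- l) N (u - P i u).
Proof.
elim: l m u => [|j l IH] [|m] u hu.
- by rewrite mul0r big_nil.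
- by have -> : u = 0 by [exact: (hu [::])]; rewrite big_nil N0 mulr0.
- by rewrite mul0r sumr_ge0.
rewrite big_cons (NP j) mulrDr.
have -> : \sum_(i <- l) N (u - P i u) =
    \sum_(i <- l) N (P j u - P i (P j u)) +
    \sum_(i <- l) N ((u - P j u) - P i (u - P j u)).
  rewrite -big_split; apply: eq_bigr => i _.
  rewrite (NP j (u - P i u)) !PB PC; congr (_ + N _).
  by rewrite !opprB addrACA [RHS]addrACA; congr (_ + _); rewrite addrC.
rewrite addrCA lerD//.
  apply: IH => T sT hT; rewrite foldrP; apply: (hu (j :: T)) => /=.
    by rewrite eqxx.
  by rewrite addnS.
(* The head's own term [N (u - P j u)] pays for one of the [m.+1] copies. *)
rewrite -nat1r mulrDl mul1r lerD2l; apply: IH => T sT hT.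
rewrite foldrB foldrP hu ?P0 ?subrr//.
exact: subseq_trans sT (subseq_cons _ _).
Qed.

End commuting_projections.

(** * A Poincare inequality for functions invariant under a code *)

Section coordinate_averages.
Context {R : realType} {H : normedModType R} {J : finType} {A : finZmodType}.
Variable B : H -> H -> R.
Hypothesis BD : forall u v w, B (u + v) w = B u w + B v w.
Hypothesis BZ : forall a u w, B (a *: u) w = a * B u w.
Hypothesis BC : forall u v, B u v = B v u.
Hypothesis B_norm : forall u, `|u| ^+ 2 = B u u.

Local Notation X := {ffun J -> A}.
Local Notation V := {ffun X -> H}.

Definition delta (j : J) (a : A) : X := [ffun i => if i == j then a else 0].

(** The conditional expectation given all coordinates but [j]. *)
Definition avg (j : J) (g : V) : V :=
  [ffun x : X => #|A|%:R^-1 *: \sum_(a : A) g (x + delta j a)].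

Definition sqnorm (g : V) : R := \sum_x `|g x| ^+ 2.

Lemma deltaE j a i : delta j a i = if i == j then a else 0.
Proof. by rewrite ffunE. Qed.

Lemma deltaD j a b : delta j (a + b) = delta j a + delta j b.
Proof. by apply/ffunP => i; rewrite !ffunE; case: ifP; rewrite ?addr0. Qed.

Lemma avgB j (g h : V) : avg j (g - h) = avg j g - avg j h.
Proof.
apply/ffunP => x; rewrite !ffunE -scalerBr -sumrB; congr (_ *: _).
by apply: eq_bigr => a _; rewrite !ffunE.
Qed.

Lemma avgC i j (g : V) : avg i (avg j g) = avg j (avg i g).
Proof.
apply/ffunP => x; rewrite !ffunE; congr (_ *: _).
under eq_bigr do rewrite ffunE; under [RHS]eq_bigr do rewrite ffunE.
rewrite -!scaler_sumr exchange_big; congr (_ *: _).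
by apply: eq_bigr => a _; apply: eq_bigr => b _; rewrite addrAC.
Qed.

Lemma avg_shift j (g : V) x a : avg j g (x + delta j a) = avg j g x.
Proof.
rewrite !ffunE; congr (_ *: _).
rewrite [RHS](reindex_inj (addrI a)); apply: eq_bigr => b _.
by rewrite deltaD addrA.
Qed.

Let card_neq0 : #|A|%:R != 0 :> R.
Proof. by rewrite pnatr_eq0 -lt0n; apply/card_gt0P; exists 0. Qed.

Let B_sum (I : finType) (F : I -> H) w : B (\sum_i F i) w = \sum_i B (F i) w.
Proof.
have B0 : B 0 w = 0 by rewrite -(scale0r 0) BZ mul0r.
by apply: (big_morph (B^~ w)) => // u v; exact: BD.
Qed.

Let BNl u v : B (- u) v = - B u v.
Proof. by rewrite -scaleN1r BZ mulN1r. Qed.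

(** Pythagoras: along coordinate [j], [avg j g] is constant and [g - avg j g] sums to zero. *)
Lemma sqnorm_avg j (g : V) :
  sqnorm g = sqnorm (avg j g) + sqnorm (g - avg j g).
Proof.
have orth : \sum_x B (g x - avg j g x) (avg j g x) = 0.
  pose c := #|A|%:R : R.
  suff e : c * (\sum_x B (g x) (avg j g x)) =
           c * (\sum_x B (avg j g x) (avg j g x)).
    under eq_bigr do rewrite BD BNl.
    by rewrite sumrB; apply/eqP; rewrite subr_eq0; apply/eqP/(mulfI card_neq0).
  (* Only the first argument is unfolded; the second is shifted along with it by [avg_shift]. For
     each [a] the shift permutes the words. *)
  have -> : c * (\sum_x B (avg j g x) (avg j g x)) =
      \sum_(x : X) \sum_a B (g (x + delta j a)) (avg j g (x + delta j a)).
    rewrite mulr_sumr; apply: eq_bigr => x _.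
    rewrite -BZ {1}ffunE scalerA mulfV ?card_neq0// scale1r B_sum.
    by apply: eq_bigr => a _; rewrite avg_shift.
  rewrite exchange_big /=.
  transitivity (\sum_(a : A) \sum_x B (g x) (avg j g x)).
    by rewrite sumr_const /c mulr_natl.
  by apply: eq_bigr => a _; rewrite (reindex_inj (addIr (delta j a))).
rewrite -[RHS]addr0 -(mulr0 2) -orth /sqnorm mulr_sumr -!big_split /=.
apply: eq_bigr => x _.
have -> : (g - avg j g) x = g x - avg j g x.
  by rewrite ffunE [X in _ + X]ffunE.
move: (avg j g x) => a; rewrite -{1}(subrK a (g x)); move: (g x - a) => u.
by rewrite !B_norm !BD !(BC _ (_ + _)) !BD (BC a u); ring.
Qed.

Lemma sum_avg j (g : V) : \sum_x avg j g x = \sum_x g x.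
Proof.
under eq_bigr do rewrite ffunE; rewrite -scaler_sumr exchange_big /=.
transitivity (#|A|%:R^-1 *: \sum_(a : A) \sum_x g x); last first.
  by rewrite sumr_const -[X in _ *: X]scaler_nat scalerA mulVf ?card_neq0// scale1r.
congr (_ *: _); apply: eq_bigr => a _.
by rewrite [RHS](reindex_inj (addIr (delta j a))).
Qed.

Lemma avg_translate j (g : V) y :
  (forall x, g (x + y) = g x) -> forall x, avg j g (x + y) = avg j g x.
Proof.
by move=> gy x; rewrite !ffunE; congr (_ *: _); apply: eq_bigr => a _; rewrite addrAC gy.
Qed.

(** For [m = s.+1], [spectral_gap] asks that averages over all but at most [s] coordinates vanish.
    Such an average ignores the coordinates in [T], and interpolation lets the code prescribe the
    others, so it is constant, hence zero. *)
Lemma poincare (s : nat) (C : Type) (ev : C -> X) (g : V) :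
  (forall (S : {set J}) (v : X), (#|S| <= s)%N ->
     exists c, forall j, j \in S -> ev c j = v j) ->
  (forall c x, g (x + ev c) = g x) -> \sum_x g x = 0 ->
  s.+1%:R * sqnorm g <= \sum_j sqnorm (g - avg j g).
Proof.
move=> interp inv sum0.
have N0 : sqnorm 0 = 0.
  by rewrite /sqnorm big1 // => x _; rewrite ffunE normr0 expr0n.
have N_ge0 h : 0 <= sqnorm h by apply: sumr_ge0 => x _; exact: sqr_ge0.
apply: (spectral_gap avgB avgC N0 N_ge0 sqnorm_avg) => T sT szT.
set h := foldr _ _ _.
have hC c x : h (x + ev c) = h x.
  rewrite /h; elim: T {sT szT h} x => [|j T IH] x /=; first exact: inv.
  exact: avg_translate.
have hT j a x : j \in T -> h (x + delta j a) = h x.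
  rewrite /h; elim: T {sT szT hC h} x => [|i T IH] x //=.
  rewrite inE => /predU1P[->|jT]; first exact: avg_shift.
  by apply: avg_translate => {}x; exact: IH.
have uT : uniq T by apply: subseq_uniq sT _; exact: index_enum_uniq.
have hconst x y : h x = h y.
  (* Translation by [ev c] makes [x] agree with [y] outside [T]; the rest [z] is supported on [T],
     where [h] is invariant. *)
  have [|c evc] := interp [set j | j \notin T] (y - x).
    have -> : [set j | j \notin T] = ~: [set j in T].
      by apply/setP => j; rewrite !inE.
    rewrite cardsCs finset.setCK -(leq_add2r (size T)).
    have -> : #|[set j in T]| = size T by rewrite cardsE; apply/card_uniqP.
    rewrite subnK; last by rewrite -(card_uniqP uT) max_card.
    by move: szT; rewrite addSn ltnS -[index_enum J]enumT -cardE.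
  rewrite -(hC c x); set z := y - (x + ev c).
  have -> : y = x + ev c + z by rewrite /z addrC subrK.
  have -> : z = \sum_(j <- T) delta j (z j).
    apply/ffunP => j; rewrite sum_ffunE.
    have [jT|jT] := boolP (j \in T).
      rewrite (bigD1_seq j) //= deltaE eqxx big1 ?addr0// => i ij.
      by rewrite deltaE eq_sym (negPf ij).
    rewrite big_seq big1 => [|i iT]; last first.
      by rewrite deltaE; case: eqP => // ji; rewrite ji iT in jT.
    by rewrite !ffunE evc ?inE// !ffunE [x j + _]addrC subrK subrr.
  have : {subset T <= T} by [].
  elim: {1 3}T (x + ev c) => [|j l IH] w lT; first by rewrite big_nil addr0.
  rewrite big_cons addrA -IH ?hT//; first by apply: lT; rewrite mem_head.
  by move=> i il; apply: lT; rewrite inE il orbT.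
have sum_h : \sum_x h x = 0.
  rewrite /h; elim: T {sT szT h hC hT uT hconst} => //= j T.
  by rewrite sum_avg.
apply/ffunP => x; rewrite ffunE.
move: sum_h; under eq_bigr do rewrite (hconst _ x).
rewrite sumr_const -scaler_nat => /eqP; rewrite scaler_eq0 pnatr_eq0 => /orP[|/eqP//].
by rewrite -leqn0 leqNgt => /negP[]; apply/card_gt0P; exists 0.
Qed.

Let cardX_gt0 : 0 < #|X|%:R :> R.
Proof. by rewrite ltr0n; apply/card_gt0P; exists 0. Qed.

(** Both sides are compared with the variance of [F]. In the 8, one factor 2 comes from keeping half
    of the pairs, one from [par], and one because [x] and [y] each contribute [sqnorm g]. *)
Lemma code_distortion (s : nat) (C : Type) (ev : C -> X) (F : X -> H)
    (alpha beta : R) :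
  (forall (S : {set J}) (v : X), (#|S| <= s)%N ->
     exists c, forall j, j \in S -> ev c j = v j) ->
  (forall c x, F (x + ev c) = F x) ->
  (forall x j a, `|F x - F (x + delta j a)| <= beta) ->
  (forall x, (#|X| <= 2 * #|[set y | (alpha <= `|F x - F y|)%R]|)%N) ->
  0 <= alpha -> s.+1%:R * alpha ^+ 2 <= 8 * #|J|%:R * beta ^+ 2.
Proof.
move=> interp inv short far alpha0.
pose mu := #|X|%:R^-1 *: \sum_x F x.
pose g : V := [ffun x => F x - mu].
have gB x y : g x - g y = F x - F y by rewrite !ffunE opprB addrA subrK.
have g_inv c x : g (x + ev c) = g x by rewrite !ffunE inv.
have sum_g : \sum_x g x = 0.
  under eq_bigr do rewrite ffunE.
  rewrite sumrB sumr_const -[X in _ - X]scaler_nat scalerA mulfV ?scale1r ?subrr//.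
  by rewrite gt_eqF.
have upper j : sqnorm (g - avg j g) <= #|X|%:R * beta ^+ 2.
  rewrite mulr_natl -sumr_const; apply: ler_sum => x _.
  have beta0 : 0 <= beta by apply: le_trans (short x j 0).
  rewrite ler_pXn2r ?nnegrE//.
  (* The deviation from the average is a mean of increments along [j], each of norm at most
     [beta]. *)
  have -> : (g - avg j g) x =
      #|A|%:R^-1 *: \sum_(a : A) (F x - F (x + delta j a)).
    rewrite ffunE [X in _ + X]ffunE [avg j g x]ffunE.
    under [in RHS]eq_bigr do rewrite -gB.
    rewrite sumrB sumr_const scalerBr -[X in _ = _ *: X - _]scaler_nat.
    by rewrite scalerA mulVf ?card_neq0// scale1r.
  rewrite normrZ ger0_norm ?invr_ge0 ?ler0n// ler_pdivrMl ?lt0r ?card_neq0 ?ler0n//.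
  rewrite mulr_natl -sumr_const.
  by apply: le_trans (ler_norm_sum _ _ _) _; exact: ler_sum.
have lower : #|X|%:R * alpha ^+ 2 <= 8 * sqnorm g.
  have h x : #|X|%:R * alpha ^+ 2 <= 2 * \sum_y `|F x - F y| ^+ 2.
    apply: (@le_trans _ _ (2 * (#|[set y | (alpha <= `|F x - F y|)%R]|%:R * alpha ^+ 2))).
      rewrite mulrA -natrM ler_wpM2r ?sqr_ge0// ler_nat; exact: far.
    rewrite ler_pM2l// mulr_natl -sumr_const.
    rewrite [leRHS](bigID [in [set y | (alpha <= `|F x - F y|)%R]]) /=.
    rewrite -[leLHS]addr0 lerD ?sumr_ge0//.
    apply: ler_sum => y; rewrite inE => hy.
    by rewrite ler_pXn2r ?nnegrE.
  have par u v : `|u - v| ^+ 2 <= 2 * (`|u| ^+ 2 + `|v| ^+ 2) :> R.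
    have := ler_normB u v; have := normr_ge0 (u - v).
    move: `|u - v| `|u| `|v| => a b c a0 abc.
    have : a ^+ 2 <= (b + c) ^+ 2 by rewrite ler_pXn2r ?nnegrE// (le_trans a0).
    have := sqr_ge0 (b - c); nra.
  rewrite -(ler_pM2l cardX_gt0).
  have : \sum_(x : X) #|X|%:R * alpha ^+ 2 <=
         \sum_(x : X) 2 * \sum_y `|F x - F y| ^+ 2 by exact: ler_sum.
  rewrite sumr_const -[X in X <= _]mulr_natl => h'; apply: (le_trans h').
  have -> : #|X|%:R * (8 * sqnorm g) =
      \sum_(x : X) 2 * \sum_y 2 * (`|g x| ^+ 2 + `|g y| ^+ 2).
    under eq_bigr do rewrite -mulr_sumr big_split /= sumr_const.
    rewrite -!mulr_sumr big_split /= sumr_const sumrMnl -/(sqnorm g).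
    by rewrite -[X in X + _]mulr_natl -[X in _ + X]mulr_natl; ring.
  apply: ler_sum => x _; rewrite ler_pM2l//; apply: ler_sum => y _.
  by rewrite -gB.
have main := poincare interp g_inv sum_g.
have : \sum_j sqnorm (g - avg j g) <= #|J|%:R * (#|X|%:R * beta ^+ 2).
  by rewrite [leRHS]mulr_natl -sumr_const; exact: ler_sum.
move/(le_trans main) => {}main.
rewrite -(ler_pM2l cardX_gt0).
have : s.+1%:R * (#|X|%:R * alpha ^+ 2) <= s.+1%:R * (8 * sqnorm g).
  by rewrite ler_wpM2l.
move: main; lra.
Qed.

End coordinate_averages.


(** * Hamming balls and neighbourhoods of a code *)

Section hamming.
Context {J : finType} {A : finZmodType}.
Local Notation X := {ffun J -> A}.
Implicit Types x y z : X.

Definition weight x : nat := #|[set j | x j != 0]|.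

(** A Chernoff-type bound: a zero entry is charged [#|A|], any other entry 1, so a coordinate totals
    at most [2 * #|A|]. *)
Lemma card_weight_le (r : nat) : (r <= #|J|)%N ->
  (#|[set x | weight x <= r]| * #|A| ^ (#|J| - r) <= 2 ^ #|J| * #|A| ^ #|J|)%N.
Proof.
move=> rJ.
have A_gt0 : (0 < #|A|)%N by apply/card_gt0P; exists 0.
pose F (a : A) := if a == 0 then #|A| else 1%N.
have prodF x : (\prod_j F (x j) = #|A| ^ (#|J| - weight x))%N.
  rewrite (bigID (fun j => x j == 0)) /= [X in (_ * X)%N]big1 => [|j]; last first.
    by rewrite /F => /negPf ->.
  rewrite muln1 (eq_bigr (fun=> #|A|)) => [|j]; last by rewrite /F => ->.
  rewrite prod_nat_const /weight -(cardC [pred j | x j != 0]) cardsE addKn.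
  by congr (_ ^ _)%N; apply: eq_card => j; rewrite !inE negbK.
have -> : (2 ^ #|J| * #|A| ^ #|J| = \prod_(j : J) (2 * #|A|))%N.
  by rewrite prod_nat_const expnMn.
(* Expand the product: the function x contributes #|A| ^ (#|J| - weight x). *)
apply: (@leq_trans (\prod_(j : J) \sum_(a : A) F a)); last first.
  apply: leq_prod => j _; rewrite (bigD1 0) //= {1}/F eqxx mul2n -addnn leq_add2l.
  rewrite (eq_bigr (fun=> 1%N)) => [|a /negPf]; last by rewrite /F => ->.
  by rewrite sum1_card max_card.
rewrite bigA_distr_bigA /= -sum_nat_const.
rewrite [leqRHS](bigID [in [set x : X | weight x <= r]%N]) /=.
apply: leq_trans (leq_addr _ _); apply: leq_sum => x; rewrite inE => xr.
by rewrite prodF leq_pexp2l// leq_sub2l.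
Qed.

Lemma card_near_code (C : finType) (ev : C -> X) (r : nat) x :
  (#|[set y : X | [exists c, weight (x - y - ev c)%R <= r]]| <=
   #|C| * #|[set x | weight x <= r]|)%N.
Proof.
rewrite -[#|C|]cardsT -cardsX.
apply: leq_trans (leq_imset_card (fun cz : C * X => x - ev cz.1 - cz.2) _).
apply/subset_leq_card/fintype.subsetP => y; rewrite inE => /existsP[c hc].
apply/imsetP; exists (c, x - y - ev c); first by rewrite !inE.
by rewrite /= !opprB subrKA addrC subrK.
Qed.
End hamming.

(** * Reed-Solomon codes: interpolation and sparsity *)

Section reed_solomon.
Context {K : finFieldType} (s : nat).

Definition rs_eval (c : 'rV[K]_s) : {ffun K -> K} :=
  [ffun j => \sum_i c 0 i * j ^+ i].

Lemma rs_evalD c c' : rs_eval (c + c') = rs_eval c + rs_eval c'.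
Proof.
apply/ffunP => j; rewrite !ffunE -big_split; apply: eq_bigr => i _.
by rewrite mxE mulrDl.
Qed.

(** A new node [j] is corrected by a multiple of the product [Q] that vanishes at the other
    nodes. *)
Lemma newton_interpolation (v : K -> K) (l : seq K) : uniq l ->
  exists2 P : {poly K}, (size P <= size l)%N & {in l, forall j, P.[j] = v j}.
Proof.
elim: l => [|j l IH] /=; first by exists 0; rewrite ?size_poly0.
case/andP=> jl /IH[P szP hP].
pose Q := \prod_(i <- l) ('X - i%:P).
have Qj : Q.[j] != 0 by have := root_prod_XsubC l j; rewrite (negPf jl) rootE => ->.
exists (P + ((v j - P.[j]) / Q.[j]) *: Q).
  apply: leq_trans (size_polyD _ _) _; rewrite geq_max (leqW szP) /=.
  by apply: leq_trans (size_scale_leq _ _) _; rewrite size_prod_XsubC.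
move=> i; rewrite hornerD hornerZ inE => /predU1P[->|il].
  by rewrite mulfVK// addrC subrK.
have -> : Q.[i] = 0 by apply/eqP; have := root_prod_XsubC l i; rewrite il rootE.
by rewrite mulr0 addr0 hP.
Qed.

Lemma rs_interpolation (S : {set K}) (v : {ffun K -> K}) : (#|S| <= s)%N ->
  exists c, forall j, j \in S -> rs_eval c j = v j.
Proof.
rewrite cardE => szS; have [P szP hP] := newton_interpolation v (enum_uniq S).
exists (\row_i P`_i) => j jS; rewrite -hP ?mem_enum//.
rewrite (horner_coef_wide _ (leq_trans szP szS)) ffunE.
by apply: eq_bigr => i _; rewrite mxE.
Qed.

End reed_solomon.

Lemma card_near_rs (K : finFieldType) (s : nat) (x : {ffun K -> K}) :
  (16 <= #|K|)%N -> (4 * s <= #|K|)%N ->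
  (2 * #|[set y : {ffun K -> K} |
      [exists c : 'rV[K]_s, weight (x - y - rs_eval c)%R <= #|K| %/ 4]]|
   <= #|{ffun K -> K}|)%N.
Proof.
set q := #|K|; set r := (q %/ 4)%N => q16 sq.
have near := card_near_code (@rs_eval K s) r x.
have rq : (r <= q)%N by rewrite leq_div.
have wt := card_weight_le (J := K) (A := K) rq.
apply: leq_trans (leq_mul (leqnn 2) near) _.
move: wt; rewrite card_mx mul1n !card_ffun -/q; set n := #|_|.
(* As [r] and [s] are at most [q / 4] and [q] is at least [2 ^ 4], the power [q ^ (q - r - s)] is at
   least [2 ^ (2 * q)]. *)
have : (2 * 2 ^ q * q ^ s <= q ^ (q - r))%N.
  have -> : (q - r = (q - r - s) + s)%N by rewrite /r; lia.
  rewrite expnD leq_mul2r; apply/orP; right.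
  apply: (@leq_trans ((2 ^ 4) ^ (q - r - s))%N).
    by rewrite -expnM -expnS leq_exp2l// /r; lia.
  by rewrite leq_exp2r//; rewrite /r; lia.
move: (2 ^ q)%N (expn_gt0 2 q) => a a0 h wt.
rewrite -(leq_pmul2l (m := a)); last by lia.
apply: leq_trans wt; apply: leq_trans (leq_mul (leqnn n) h); nia.
Qed.


(** * Weighted graphs that encode words *)

Lemma extend_perm (T U : finType) (i : T -> U) (p : T -> T) :
  injective i -> injective p -> exists s : {perm U}, forall v, s (i v) = i (p v).
Proof.
move=> i_inj p_inj.
pose ext u := if [pick v | i v == u] is Some v then i (p v) else u.
have extE v : ext (i v) = i (p v).
  by rewrite /ext; case: pickP => [w /eqP/i_inj -> //|/(_ v)]; rewrite eqxx.
have ext_inj : injective ext.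
  move=> u u'; rewrite {1 2}/ext.
  case: pickP => [v /eqP <-|nu]; case: pickP => [v' /eqP <-|nu'] //.
  - by move/i_inj/p_inj ->.
  - by move=> e; have := nu' (p v); rewrite e eqxx.
  - by move=> e; have := nu (p v'); rewrite -e eqxx.
by exists (perm ext_inj) => v; rewrite permE.
Qed.

Section coded_graph.
Context {R : realType} {n : nat} {J : finType} {A C : finZmodType}.
Local Notation X := {ffun J -> A}.
Local Notation I := (C * (J * A))%type.
Variables (ev : C -> X) (iota : C + J * A -> 'I_n).
Hypothesis evD : forall c d, ev (c + d) = ev c + ev d.
Hypothesis J_gt1 : (1 < #|J|)%N.
Hypothesis iota_inj : injective iota.

Let ev0 : ev 0 = 0.
Proof. by apply: (addrI (ev 0)); rewrite -evD !addr0. Qed.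

Let evN c : ev (- c) = - ev c.
Proof. by apply: (addrI (ev c)); rewrite -evD !subrr ev0. Qed.

Let edge_subproof (i : I) : #|[set iota (inl i.1); iota (inr i.2)]| == 2%N.
Proof. by rewrite cards2 (inj_eq iota_inj). Qed.

Definition edge (i : I) : two_subset n :=
  exist (fun S : {set 'I_n} => #|S| == 2%N) _ (edge_subproof i).

Lemma edge_left i f : iota (inl f) \in val (edge i) -> f = i.1.
Proof. by rewrite !inE !(inj_eq iota_inj) orbF => /eqP[]. Qed.

Lemma edge_right i p : iota (inr p) \in val (edge i) -> p = i.2.
Proof. by rewrite !inE !(inj_eq iota_inj) => /eqP[]. Qed.

Lemma edge_inj : injective edge.
Proof.
move=> i i' e; rewrite [i]surjective_pairing [i']surjective_pairing.
congr (_, _); first by apply: edge_left; rewrite -e !inE eqxx.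
by apply: edge_right; rewrite -e !inE eqxx orbT.
Qed.

(** As [edge] is injective, the sum has at most one term: this is extension by zero. *)
Definition spread (u : I -> nat) (e : two_subset n) : nat :=
  (\sum_(i | edge i == e) u i)%N.

Lemma spread_edge u i : spread u (edge i) = u i.
Proof.
rewrite /spread (eq_bigl (pred1 i)) ?big_pred1_eq// => i'.
by rewrite (inj_eq edge_inj).
Qed.

Lemma spread_out u e : (forall i, e != edge i) -> spread u e = 0%N.
Proof. by move=> h; rewrite /spread big_pred0// => i; rewrite eq_sym (negPf (h i)). Qed.

Lemma edgeP e : (exists i, e = edge i) \/ (forall i, e != edge i).
Proof.
have [/existsP[i /eqP ->]|] := boolP [exists i, e == edge i]; first by left; exists i.
by rewrite negb_exists => /forallP; right.
Qed.

(** The successor separates these weights from the 0 on all other pairs of vertices. *)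
Definition base (i : I) : nat := (enum_rank (i.2.1, i.2.2 - ev i.1 i.2.1)).+1.

Definition mark (x : X) (i : I) : nat := i.2.2 == x i.2.1.

(* Larger than what any choice of marks can save, so that a permutation moving
   a base weight is never worthwhile. *)
Definition scale : nat := (2 * #|C| * #|J|).+1.

Definition coded_graph (x : X) : edge_space R n :=
  [ffun e => (scale * spread base e + spread (mark x) e)%N%:R].

Lemma sum_edges (F : two_subset n -> R) : (forall e, 0 <= F e) ->
  \sum_i F (edge i) <= \sum_e F e.
Proof.
move=> F0; rewrite [leRHS](bigID [in [set edge i | i : I]]) /=.
rewrite big_imset /=; last by move=> ? ? _ _; exact: edge_inj.
by rewrite lerDl sumr_ge0.
Qed.

(** Where [x] and [y] differ, the marks differ at two values [a], once for each of the [#|C|] code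
    vertices. *)
Lemma sum_mark_diff (x y : X) :
  \sum_(i : I) ((mark x i)%:R - (mark y i)%:R) ^+ 2 =
  (2 * #|C| * weight (x - y)%R)%N%:R :> R.
Proof.
pose d j := \sum_a ((a == x j)%:R - (a == y j)%:R) ^+ 2 : R.
have dE j : d j = 2 * ((x - y) j != 0)%:R.
  rewrite !ffunE subr_eq0 /d; have [->|xy] := eqVneq (x j) (y j).
    by rewrite mulr0 big1 // => a _; rewrite subrr expr0n.
  have yx : y j != x j by rewrite eq_sym.
  rewrite (bigD1 (x j)) //= (bigD1 (y j)) //= !eqxx (negPf xy) (negPf yx) big1
    => [|a /andP[/negPf -> /negPf ->]].
    by rewrite addr0 /=; ring.
  by rewrite subrr expr0n.
transitivity (\sum_(f : C) \sum_j d j).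
  rewrite -(pair_bigA _ (fun (f : C) p =>
    ((mark x (f, p))%:R - (mark y (f, p))%:R) ^+ 2)) /=.
  by apply: eq_bigr => f _; rewrite pair_bigA.
rewrite sumr_const -[LHS]mulr_natl; under eq_bigr do rewrite dE.
rewrite -mulr_sumr mulrA [_ * 2]mulrC -natrM [RHS]natrM; congr (_ * _).
rewrite /weight -sum1_card natr_sum [RHS]big_mkcond /=.
by apply: eq_bigr => j _; rewrite inE; case: ifP.
Qed.

Lemma coded_graph_dist (x y : X) :
  mdist (coded_graph x) (coded_graph y) ^+ 2 = (2 * #|C| * weight (x - y)%R)%N%:R.
Proof.
rewrite /mdist /= /edist /enorm sqr_sqrtr; last first.
  by apply: sumr_ge0 => e _; exact: sqr_ge0.
rewrite -sum_mark_diff [LHS](bigID [in [set edge i | i : I]]) /=.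
rewrite big_imset /=; last by move=> ? ? _ _; exact: edge_inj.
rewrite [X in _ + X]big1 ?addr0 => [|e he].
  apply: eq_bigr => i _; rewrite !ffunE !spread_edge !natrD; congr (_ ^+ 2); ring.
rewrite !ffunE !(@spread_out _ e) ?subrr ?expr0n// => i; apply: contra he => /eqP ->.
all: exact: imset_f.
Qed.

Lemma relabel_inj (t : {perm 'I_n}) : injective (relabel t).
Proof.
move=> e e' h; apply: val_inj; apply: (imset_inj (@perm_inj _ t)).
exact: (congr1 val h).
Qed.

Lemma coded_graph_translate x c :
  exists s : {perm 'I_n}, edge_act_fun (coded_graph x) s = coded_graph (x + ev c).
Proof.
(* Acting by [t^-1] evaluates the graph at pairs moved by [t]; hence the shift by [- c]. It
   preserves [a - ev f j], so [base] is unchanged. *)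
pose p (v : C + J * A) := match v with
  | inl f => inl (f - c) | inr (j, a) => inr (j, a - ev c j) end.
have p_inj : injective p.
  by move=> [f|[j a]] [f'|[j' a']] //= [] => [/addIr -> //|->] /addIr ->.
have [t tE] := extend_perm iota_inj p_inj.
have tedge i : relabel t (edge i) = edge (i.1 - c, (i.2.1, i.2.2 - ev c i.2.1)).
  apply: val_inj; rewrite /= imsetU1 imset_set1 !tE /=.
  by case: i => f [j a].
exists t^-1%g; apply/ffunP => e; rewrite !ffunE invgK.
have [[[f [j a]] ->]|out] := edgeP e.
  rewrite tedge !spread_edge /base /mark /= evD evN !ffunE; congr (_ * _ + _)%N%:R.
    by congr (enum_rank (_, _)).+1; rewrite opprD opprK addrACA addNr addr0.
  by rewrite subr_eq.
rewrite !(spread_out _ out) !(@spread_out _ (relabel t e))// => -[f [j a]].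
all: apply: contraNneq (out (f + c, (j, a + ev c j))) => h; apply/eqP/(@relabel_inj t).
all: by rewrite h tedge /= !addrK.
Qed.

(** An edge can only go to an edge with the same [j] and the same [a - ev f j], so the image of code
    vertex 0 determines the shift of every [(j, a)]. The code vertex [f] stays unspecified because
    marks ignore it. *)
Lemma base_automorphism (t : {perm 'I_n}) :
  (forall e, spread base (relabel t e) = spread base e) ->
  exists c, forall i, exists f,
    relabel t (edge i) = edge (f, (i.2.1, i.2.2 + ev c i.2.1)).
Proof.
move=> tb.
have step i : exists f a, relabel t (edge i) = edge (f, (i.2.1, a)) /\
    a - ev f i.2.1 = i.2.2 - ev i.1 i.2.1.
  have := tb (edge i); rewrite spread_edge.
  have [[[f [j a]] e]|out] := edgeP (relabel t (edge i)); last by rewrite spread_out.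
  rewrite e spread_edge => -[/ord_inj/enum_rank_inj[/= ji hd]].
  by exists f, a; rewrite -hd ji.
have mem i v : v \in val (edge i) -> t v \in val (relabel t (edge i)).
  by move=> vi; apply: imset_f.
have left i : iota (inl i.1) \in val (edge i) by rewrite !inE eqxx.
have right i : iota (inr i.2) \in val (edge i) by rewrite !inE eqxx orbT.
(* Code vertex 0 lies on edges with two different [j], so its image cannot be a vertex [(j, a)]. *)
have [c tc] : exists c, t (iota (inl 0)) = iota (inl c).
  have h j : exists f a, t (iota (inl 0)) = iota (inl f) \/
      t (iota (inl 0)) = iota (inr (j, a)).
    have [f [a [e _]]] := step (0, (j, 0)).
    have := mem _ _ (left (0, (j, 0))); rewrite e !inE => /orP[]/eqP ->.
      by exists f, a; left.
    by exists f, a; right.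
  have /card_gt1P[j1 [j2 [_ _ j12]]] := J_gt1.
  have [f1 [a1 [->|e1]]] := h j1; first by exists f1.
  have [f2 [a2 [->|]]] := h j2; first by exists f2.
  by rewrite e1 => /iota_inj[j12']; rewrite j12' eqxx in j12.
have tp j a : t (iota (inr (j, a))) = iota (inr (j, a + ev c j)).
  have [f [b [e hb]]] := step (0, (j, a)).
  have := mem _ _ (left (0, (j, a))); rewrite e tc => /edge_left /= cf.
  move: hb; rewrite -cf /= ev0 ffunE subr0 => /eqP; rewrite subr_eq => /eqP hb.
  have := mem _ _ (right (0, (j, a))); rewrite e /= !inE => /orP[]/eqP.
    by rewrite -cf -tc => /perm_inj/iota_inj.
  by rewrite hb.
exists c => -[f [j a]]; have [f' [b [e _]]] := step (f, (j, a)); exists f'.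
have := mem _ _ (right (f, (j, a))); rewrite e tp => /edge_right /= [->].
by [].
Qed.

(** If the permutation preserves [base], it translates the marks by a codeword and the marks alone
    give the bound. Otherwise a single pair of vertices with changed base weight does. *)
Lemma coded_graph_far x y (r : nat) (s : {perm 'I_n}) :
  (forall c, r <= weight (x - y - ev c)%R)%N ->
  (2 * #|C| * r)%N%:R <= mdist (coded_graph x) (edge_act_fun (coded_graph y) s) ^+ 2.
Proof.
move=> far; rewrite /mdist /= /edist /enorm sqr_sqrtr; last first.
  by apply: sumr_ge0 => e _; exact: sqr_ge0.
set t := (s^-1)%g.
have term e : (coded_graph x - edge_act_fun (coded_graph y) s) e =
    (scale * spread base e + spread (mark x) e)%N%:R -
    (scale * spread base (relabel t e) + spread (mark y) (relabel t e))%N%:R.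
  by rewrite !ffunE.
have [/forallP tb|] := boolP [forall e, spread base (relabel t e) == spread base e].
  have [c tc] := base_automorphism (fun e => eqP (tb e)).
  (* The marks of [y] on the moved edges are those of [y - ev c]. *)
  apply: (@le_trans _ _ (2 * #|C| * weight (x - (y - ev c))%R)%N%:R).
    rewrite ler_nat leq_mul2l; apply/orP; right.
    by have := far (- c); rewrite evN opprB addrA opprK addrAC.
  rewrite -sum_mark_diff.
  apply: le_trans (sum_edges (F := fun e => _ e ^+ 2) _) => [|e]; last exact: sqr_ge0.
  apply: ler_sum => -[f [j a]] _; rewrite term (eqP (tb _)) !natrD.
  have [f' ->] := tc (f, (j, a)); rewrite !spread_edge /mark /= !ffunE.
  rewrite (eq_sym a (y j - _)) subr_eq (eq_sym (y j)).
  by rewrite le_eqVlt; apply/orP; left; apply/eqP; congr (_ ^+ 2); ring.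
rewrite negb_forall => /existsP[e eb].
have mark1 z e' : (spread (mark z) e' <= 1)%N.
  have [[i ->]|out] := edgeP e'; last by rewrite spread_out.
  by rewrite spread_edge /mark leq_b1.
rewrite (bigD1 e) //= -[leLHS]addr0 lerD ?sumr_ge0// => [|? _]; last exact: sqr_ge0.
rewrite term.
have := mark1 x e; have := mark1 y (relabel t e).
move: (spread base e) (spread base (relabel t e)) eb.
move: (spread (mark x) e) (spread (mark y) _) => m m' b b' bb' m'1 m1.
have rJ : (r <= #|J|)%N by apply: leq_trans (far 0) (max_card _).
have : (2 * #|C| * r <= 2 * #|C| * #|J|)%N by rewrite leq_mul2l rJ orbT.
rewrite /scale; move: (2 * #|C| * #|J|)%N (2 * #|C| * r)%N => k l lk.
rewrite -real_normK ?num_real//.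
apply: (@le_trans _ _ (k%:R ^+ 2)).
  by rewrite -natrX ler_nat; nia.
rewrite ler_pXn2r ?nnegrE//.
(* Unequal base weights differ by at least [k.+1] after scaling, and the marks recover at most 1. *)
have far_apart u u' v v' : (u < u')%N -> (v <= 1)%N -> (v' <= 1)%N ->
    k%:R <= `|(k.+1 * u' + v')%N%:R - (k.+1 * u + v)%N%:R| :> R.
  move=> uu' v1 v'1; have h : (k.+1 * u + v + k <= k.+1 * u' + v')%N.
    have : (k.+1 * u.+1 <= k.+1 * u')%N by rewrite leq_mul2l.
    by rewrite mulnS; lia.
  rewrite -natrB ?normr_nat ?ler_nat; last exact: leq_trans (leq_addr _ _) h.
  by rewrite -(leq_add2l (k.+1 * u + v)) subnKC// (leq_trans (leq_addr _ _) h).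
case: (ssrnat.ltngtP b b') bb' => // h _; first by rewrite distrC; exact: far_apart.
exact: far_apart.
Qed.

End coded_graph.


(** * Distortion through real constants *)

Section distortion_bound.
Context {R : realType} {X : metricType R} {H : normedModType R}.
Variable f : X -> H.
Local Notation dH := (fun u v : H => `|u - v|).

(** If the distortion is not set to [+oo], both extremal constants are finite and satisfy the
    two-sided bound themselves. The pair at positive distance keeps [lower_const] finite. *)
Lemma distortion_ge (K : R) : (exists x y : X, 0 < mdist x y) ->
  (forall a b : R, 0 <= a -> 0 <= b ->
     (forall x y, a * mdist x y <= `|f x - f y| <= b * mdist x y) ->
     K * a <= b) ->
  (K%:E <= distortion (@mdist R X) dH f)%E.
Proof.
move=> [x0 [y0 d0]] hK; rewrite /distortion.
set L := lower_const _ _ _; set U := upper_const _ _ _.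
case: ifPn => [_|]; first exact: leey.
rewrite negb_or => /andP[L0 Uoo].
have L_ge0 : (0 <= L)%E.
  by apply: ereal_sup_ubound; split => // x x'; rewrite mul0e lee_fin.
have U_ge0 : (0 <= U)%E by apply: le_ereal_inf_tmp => b [].
have L_le x y : 0 < mdist x y -> (L <= (`|f x - f y| / mdist x y)%:E)%E.
  move=> d; apply: ge_ereal_sup => -[a| |] [] a0 /(_ x y); last by rewrite leNye.
    2: by rewrite gt0_mulye ?lte_fin.
  by rewrite -EFinM !lee_fin ler_pdivlMr.
have [l Ll] : exists l, L = l%:E.
  have := L_le _ _ d0; move: L_ge0.
  by case: (L) => [l|//|//] _ _; exists l.
have [u Uu] : exists u, U = u%:E.
  by move: U_ge0 Uoo; case: (U) => [u|//|//] _ _; exists u.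
have l_gt0 : 0 < l by rewrite lt0r -lee_fin -Ll L_ge0 -eqe -Ll L0.
have u_ge0 : 0 <= u by rewrite -lee_fin -Uu.
rewrite Ll Uu inver gt_eqF// -EFinM lee_fin ler_pdivlMr//.
apply: hK => // [|x y]; first exact: ltW.
have [d|] := ltP 0 (mdist x y); last first.
  move=> d; have d0' : mdist x y = 0 by apply/eqP; rewrite eq_le d mdist_ge0.
  by rewrite d0' (mdist_positivity _ _ d0') !mulr0 subrr normr0 lexx.
apply/andP; split.
  by rewrite -ler_pdivlMr// -lee_fin -Ll L_le.
rewrite -ler_pdivrMr// -lee_fin -Uu; apply: le_ereal_inf_tmp.
move=> -[b| |] [] // b0 /(_ x y); last by rewrite leey.
by rewrite -EFinM !lee_fin ler_pdivrMr.
Qed.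

End distortion_bound.

(** * Distances between orbits *)

Section graph_orbit.
Context {R : realType} {n : nat}.
Local Notation E := (edge_space R n).
Implicit Types g h : E.

Definition orbit_pt g : graph_orbit_space R n :=
  exist _ (orbit_of (@edge_isom_act R n) g) (ex_intro _ g erefl).

Lemma orbit_pt_le g h s t :
  mdist (orbit_pt g) (orbit_pt h) <= mdist (edge_act_fun g s) (edge_act_fun h t).
Proof.
apply: ge_inf; first by exists 0 => _ [p _ [q _ <-]]; exact: mdist_ge0.
by exists (edge_act_fun g s); [exists s|exists (edge_act_fun h t) => //; exists t].
Qed.

(** Applying an inverse permutation to both representatives fixes the first one. *)
Lemma orbit_pt_ge g h (b : R) :
  (forall s, b <= mdist g (edge_act_fun h s)) ->
  b <= mdist (orbit_pt g) (orbit_pt h).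
Proof.
move=> hb; apply: lb_le_inf.
  exists (mdist (edge_act_fun g 1) (edge_act_fun h 1)).
  by exists (edge_act_fun g 1); [exists 1%g|exists (edge_act_fun h 1) => //; exists 1%g].
move=> _ [_ [s _ <-] [_ [t _ <-]] <-].
rewrite -(iactP (@edge_isom_act R n) s^-1%g) iactK -iactM.
exact: hb.
Qed.

Lemma orbit_pt_act g s : orbit_pt (edge_act_fun g s) = orbit_pt g.
Proof.
apply/mdist_positivity/eqP; rewrite eq_le mdist_ge0 andbT.
apply: le_trans (orbit_pt_le _ _ 1%g s) _.
have -> : edge_act_fun (edge_act_fun g s) 1 = edge_act_fun g s.
  exact: (iact1 (@edge_isom_act R n)).
by rewrite mdistxx.
Qed.

End graph_orbit.

Lemma hilbert_form (R : realType) (H : completeNormedModType R) : is_hilbert H ->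
  exists B : H -> H -> R,
    [/\ forall u v w, B (u + v) w = B u w + B v w,
        forall a u w, B (a *: u) w = a * B u w,
        forall u v, B u v = B v u &
        forall u, `|u| ^+ 2 = B u u].
Proof.
move=> [ip ipE]; exists ip; split => //.
- by move=> u v w; rewrite linearDl.
- by move=> a u w; rewrite linearZl_LR.
- by move=> u v; rewrite hermC expr0 mul1r.
Qed.

(** * Lower bound from the Reed-Solomon graphs *)

Section rs_graph.
Context {R : realType} {n : nat} {K : finFieldType} {s : nat}.
Local Notation C := 'rV[K]_s.
Local Notation X := {ffun K -> K}.
Variable iota : (C + K * K)%type -> 'I_n.
Hypothesis iota_inj : injective iota.
Hypothesis K_ge16 : (16 <= #|K|)%N.
Hypothesis sK : (4 * s <= #|K|)%N.

Let ev : C -> X := @rs_eval K s.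

Let r := (#|K| %/ 4).+1.

Let D : R := (2 * #|C|)%N%:R.

Let D_gt0 : 0 < D.
Proof. by rewrite ltr0n muln_gt0; apply/card_gt0P; exists 0. Qed.

Definition rs_pt (x : X) : graph_orbit_space R n :=
  orbit_pt (@coded_graph R n K K C ev iota iota_inj x).

Lemma rs_pt_translate c x : rs_pt (x + ev c) = rs_pt x.
Proof.
rewrite /rs_pt.
have [t <-] := coded_graph_translate (R := R) (@rs_evalD K s) iota_inj x c.
exact: orbit_pt_act.
Qed.

Lemma rs_pt_near x j a : mdist (rs_pt x) (rs_pt (x + delta j a)) <= Num.sqrt D.
Proof.
rewrite /rs_pt.
have act1 u : edge_act_fun u 1 = u := iact1 (@edge_isom_act R n) u.
apply: le_trans (orbit_pt_le _ _ 1%g 1%g) _; rewrite !act1.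
rewrite -(ler_pXn2r (ltn0Sn 1)) ?nnegrE ?sqrtr_ge0 ?mdist_ge0//.
rewrite [leRHS]sqr_sqrtr ?(ltW D_gt0)// coded_graph_dist ler_nat -[leqRHS]muln1 leq_mul2l.
apply/orP; right; rewrite -(cards1 j); apply/subset_leq_card/fintype.subsetP => i.
rewrite !inE !ffunE opprD addNKr oppr_eq0.
by case: (i == j); rewrite ?eqxx.
Qed.

Lemma rs_pt_far x : exists2 Y : {set X}, (#|X| <= 2 * #|Y|)%N &
  {in Y, forall y, Num.sqrt (D * r%:R) <= mdist (rs_pt x) (rs_pt y)}.
Proof.
set Z := [set y : X | [exists c : C, weight (x - y - ev c)%R <= #|K| %/ 4]%N].
exists (~: Z).
  have := card_near_rs x K_ge16 sK; rewrite -(cardsC Z) -/Z.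
  by move: #|Z| #|~: Z| => u v; lia.
move=> y; rewrite !inE negb_exists => /forallP far.
apply: orbit_pt_ge => t.
rewrite -(ler_pXn2r (ltn0Sn 1)) ?nnegrE ?sqrtr_ge0 ?mdist_ge0//.
rewrite [leLHS]sqr_sqrtr ?mulr_ge0 ?(ltW D_gt0)// -natrM.
apply: coded_graph_far; [exact: rs_evalD|exact: leq_trans K_ge16|].
by move=> c; rewrite /r ltnNge; exact: far.
Qed.

(** The 32 is the 8 of [code_distortion] times 4, from [#|K| <= 4 * r]; the common factor [D * r]
    cancels. *)
Lemma c2_rs_ge (k : nat) : (32 * k ^ 2 <= s.+1)%N ->
  (k%:R%:E <= c2 (graph_orbit_space R n))%E.
Proof.
move=> ks; apply: le_ereal_inf_tmp => _ [H [f [/hilbert_form[B [BD BZ BC BN]] <-]]].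
have r_gt0 : 0 < r%:R :> R by rewrite ltr0n.
apply: distortion_ge.
  have [Y cY hY] := rs_pt_far 0.
  have /card_gt0P[y yY] : (0 < #|Y|)%N.
    have : (0 < #|X|)%N by apply/card_gt0P; exists 0.
    by move: cY; lia.
  exists (rs_pt 0), (rs_pt y); apply: lt_le_trans (hY _ yY).
  by rewrite sqrtr_gt0 mulr_gt0.
move=> a b a0 b0 ab.
have : s.+1%:R * (a * Num.sqrt (D * r%:R)) ^+ 2 <=
    8 * #|K|%:R * (b * Num.sqrt D) ^+ 2.
  apply: (code_distortion BD BZ BC BN (ev := ev) (F := f \o rs_pt)).
  - exact: rs_interpolation.
  - by move=> c x; rewrite /= rs_pt_translate.
  - move=> x j c; have /andP[_ /le_trans] := ab (rs_pt x) (rs_pt (x + delta j c)).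
    by apply; rewrite ler_wpM2l// rs_pt_near.
  - move=> x; have [Y cY hY] := rs_pt_far x; apply: leq_trans cY _.
    rewrite leq_mul2l; apply/subset_leq_card/fintype.subsetP => y yY.
    rewrite inE; have /andP[/(le_trans _)] := ab (rs_pt x) (rs_pt y).
    by move=> + _; apply; rewrite ler_wpM2l// hY.
  - by rewrite mulr_ge0// sqrtr_ge0.
rewrite !exprMn !sqr_sqrtr ?mulr_ge0 ?(ltW D_gt0)// => main.
have q4 : #|K|%:R <= 4 * r%:R :> R.
  by rewrite -natrM ler_nat /r; lia.
have ks' : 32 * k%:R ^+ 2 <= s.+1%:R :> R by rewrite -natrX -natrM ler_nat.
rewrite -(ler_pXn2r (ltn0Sn 1)) ?nnegrE ?mulr_ge0// exprMn.
rewrite -(ler_pM2l (x := 32 * (D * r%:R))); last by rewrite !mulr_gt0.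
apply: (@le_trans _ _ (s.+1%:R * (a ^+ 2 * (D * r%:R)))).
  have -> : 32 * (D * r%:R) * (k%:R ^+ 2 * a ^+ 2) =
    32 * k%:R ^+ 2 * (a ^+ 2 * (D * r%:R)) by ring.
  by rewrite ler_wpM2r// !mulr_ge0 ?sqr_ge0 ?(ltW D_gt0).
apply: le_trans main _.
have -> : 32 * (D * r%:R) * b ^+ 2 = 8 * (4 * r%:R) * (b ^+ 2 * D) by ring.
by rewrite ler_wpM2r ?mulr_ge0 ?sqr_ge0 ?(ltW D_gt0)// ler_wpM2l.
Qed.

End rs_graph.

Theorem theorem31 (R : realType) :
  limn_einf (fun n : nat => c2 (graph_orbit_space R n)) = (+oo)%E.
Proof.
suff : ((fun n => c2 (graph_orbit_space R n)) @ \oo --> +oo%E)%classic.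
  by move=> /cvg_limn_einf_sup[].
apply/cvgeyPge => M.
(* [k] exceeds [M], [s] meets the hypothesis of [c2_rs_ge], and the prime makes the field large
   enough for [s]. *)
pose k := (Num.trunc M).+1; pose s := (32 * k ^ 2)%N.
have [p p_big p_prime] := prime_above (16 + 4 * s).
have cardK : #|'F_p| = p by rewrite card_Fp.
pose V := ('rV['F_p]_s + 'F_p * 'F_p)%type.
(* Every [n] from the number of vertices on works: the surplus vertices carry only zero weights. *)
exists #|{: V}| => // n /= Vn.
pose iota (v : V) := widen_ord Vn (enum_rank v).
have iota_inj : injective iota.
  by move=> v w /(congr1 val)/= /ord_inj/enum_rank_inj.
apply: le_trans (c2_rs_ge (k := k) iota_inj _ _ _); last by rewrite /s.
- rewrite lee_fin; exact: ltW (truncnS_gt M).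
- by rewrite cardK; lia.
- by rewrite cardK; lia.
Qed.
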